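(* For every finite simple graph $G$ with chromatic number $\chi(G) \geq 2$, we have $\operatorname{tlir}(G) \leq 2\chi(G) - 2$.
   Context: A total coloring of $G$ assigns a color to every vertex and every edge of $G$. For a color $c$ and a vertex $v$, the total $c$-degree of $v$ is the number of edges of color $c$ incident to $v$, plus $1$ if $v$ itself has color $c$. A total coloring is a locally irregular total coloring (TLIR coloring) if for every edge $uv$, with $c$ the color of $uv$, the total $c$-degrees of $u$ and $v$ differ. $\operatorname{tlir}(G)$ is the minimum number of colors in a TLIR coloring of $G$. *)

(* Defs.v *)
From HB Require Import structures.
From mathcomp Require Import all_boot.

Set Implicit Arguments.
Unset Strict Implicit.
Unset Printing Implicit Defensive.

Record sgraph := SGraph {
  vertex :> finType;
  adj : rel vertex;
  adj_sym : symmetric adj;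
  adj_irr : irreflexive adj }.

Section Graph.
Variable G : sgraph.

Definition edges : {set {set G}} :=
  [set A | [exists u, exists v, adj u v && (A == [set u; v])]].

Definition edge : finType := {A : {set G} | A \in edges}.

Definition proper_coloring k (f : {ffun G -> 'I_k}) : bool :=
  [forall u, forall v, adj u v ==> (f u != f v)].

Definition colorable (k : nat) : bool :=
  [exists f : {ffun G -> 'I_k}, proper_coloring f].

Lemma colorable_exists : exists k, colorable k.
Proof.
exists #|G|; apply/existsP; exists [ffun v => enum_rank v].
apply/forallP=> u; apply/forallP=> v; apply/implyP=> uv.
rewrite !ffunE (inj_eq enum_rank_inj); apply/eqP=> eq_uv.
by rewrite eq_uv adj_irr in uv.
Qed.

Definition chromatic_number : nat := ex_minn colorable_exists.

(* The palette 'I_k need not be used entirely; since unused colors can be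
   dropped, the least such k is the minimum number of colors in a coloring. *)
Definition total_coloring (k : nat) : finType := {ffun G + edge -> 'I_k}.

Definition total_degree k (f : total_coloring k) (c : 'I_k) (v : G) : nat :=
  #|[set e : edge | (v \in val e) && (f (inr e) == c)]| + (f (inl v) == c).

Definition tlir_coloring k (f : total_coloring k) : bool :=
  [forall e : edge, forall u, forall v, (val e == [set u; v]) ==>
     (total_degree f (f (inr e)) u != total_degree f (f (inr e)) v)].

Definition tlir_colorable (k : nat) : bool :=
  [exists f : total_coloring k, tlir_coloring f].

Lemma edge_set2 (e : edge) u v : val e = [set u; v] -> u != v.
Proof.
move=> def_e; have := valP e; rewrite inE => /existsP[x /existsP[y /andP[xy]]].
rewrite def_e => /eqP eq_xy; apply/eqP=> eq_uv; subst v.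
have: x \in [set u; u] by rewrite eq_xy set21.
have: y \in [set u; u] by rewrite eq_xy set22.
by rewrite !inE !orbb => /eqP yu /eqP xu; rewrite xu yu adj_irr in xy.
Qed.

(* With one color per vertex, give every vertex its own color and every edge
   the color of one of its ends: the color classes of edges are stars, whose
   center has total degree at least 2 and whose leaves have total degree 1. *)
Lemma tlir_colorable_exists : exists k, tlir_colorable k.
Proof.
have endP (e : edge) : exists x, x \in val e.
  have := valP e; rewrite inE => /existsP[x /existsP[y /andP[_ /eqP->]]].
  by exists x; rewrite set21.
pose ctr e := xchoose (endP e).
pose f : total_coloring #|G| :=
  [ffun z => enum_rank (match z with inl v => v | inr e => ctr e end)].
exists #|G|; apply/existsP; exists f.
have gt1 (e : edge) : 1 < total_degree f (f (inr e)) (ctr e).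
  rewrite /total_degree !ffunE eqxx addn1 ltnS card_gt0; apply/set0Pn; exists e.
  by rewrite inE !ffunE eqxx andbT /ctr (xchooseP (endP e)).
have le1 (e : edge) v : v \in val e -> v != ctr e -> total_degree f (f (inr e)) v <= 1.
  move=> ve vc; rewrite /total_degree !ffunE (inj_eq enum_rank_inj) (negPf vc).
  rewrite addn0 -(cards1 e); apply/subset_leq_card/subsetP=> e'.
  rewrite !inE ffunE (inj_eq enum_rank_inj) => /andP[ve' /eqP eq_c].
  have ce := xchooseP (endP e); have ce' := xchooseP (endP e').
  rewrite -/(ctr _) in ce; rewrite -/(ctr _) eq_c in ce'.
  have two (d : edge) : v \in val d -> ctr e \in val d -> val d = [set v; ctr e].
    have := valP d; rewrite inE => /existsP[x /existsP[y /andP[_ /eqP->]]].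
    rewrite !inE => /orP[]/eqP ? /orP[]/eqP E; rewrite -?E; subst v => //.
    - by rewrite E eqxx in vc.
    - by rewrite setUC.
    - by rewrite E eqxx in vc.
  by apply/eqP/val_inj; rewrite (two e) // (two e').
apply/forallP=> e; apply/forallP=> u; apply/forallP=> v; apply/implyP=> /eqP def_e.
have uv := edge_set2 def_e.
have ue: u \in val e by rewrite def_e set21.
have ve: v \in val e by rewrite def_e set22.
have: ctr e \in val e := xchooseP (endP e).
rewrite def_e !inE => /orP[]/eqP c.
- by rewrite neq_ltn orbC -c (leq_ltn_trans _ (gt1 e)) // le1 // c eq_sym.
- by rewrite neq_ltn -c (leq_ltn_trans _ (gt1 e)) // le1 // c.
Qed.

Definition tlir : nat := ex_minn tlir_colorable_exists.

End Graph.

(* Main.v *)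
(** Let V_0, ..., V_{q+1} be the classes of a proper coloring with q + 2 = chi
    colors, and use colors a_i = 2i and b_i = 2i + 1 for i <= q. Color the edges
    from V_i to higher classes with a_i. A vertex of V_i can choose between a_i
    and b_i as its own color, which fixes the parity of its a_i-degree: odd for
    i <= q, and even for V_{q+1}, which uses a_q and b_q. For i < q the vertices
    above V_i must have even a_i-degree without such a choice, so each one with
    an odd number of neighbors in V_i takes one of those edges out of a_i. The
    edges taken out form stars centered in V_i. Stars with at least two leaves
    are colored b_i. A star with a single leaf v is colored with the a-color of
    v: its center then has degree 1 in that color, while v, which still adjusts
    its own degree, can avoid the value 1. *)

Require Import Defs.
From mathcomp Require Import all_boot.
From mathcomp Require Import zify.

Set Implicit Arguments.
Unset Strict Implicit.
Unset Printing Implicit Defensive.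

(** * Total colorings given by [nat]-valued functions on vertices and ordered pairs *)

Section NeighborColoring.
Variables (G : sgraph) (vc : G -> nat) (ec : G -> G -> nat).

Definition color_nbrs c v : {set G} := [set w | adj v w & ec v w == c].

Definition color_degree c v := #|color_nbrs c v| + (vc v == c).

Hypothesis ec_sym : forall u v, adj u v -> ec u v = ec v u.

Lemma edge_ends (e : edge G) : exists p : G * G, adj p.1 p.2 && (val e == [set p.1; p.2]).
Proof.
have := valP e; rewrite inE => /existsP[u /existsP[v uv]].
by exists (u, v).
Qed.

Definition edge_color (e : edge G) : nat :=
  let p := xchoose (edge_ends e) in ec p.1 p.2.

Lemma edge_adj (e : edge G) u v : val e = [set u; v] -> adj u v.
Proof.
move=> def_e; have uv := edge_set2 def_e.
have := valP e; rewrite inE => /existsP[x /existsP[y /andP[xy /eqP]]].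
rewrite def_e => eq_xy.
have: u \in [set x; y] by rewrite -eq_xy set21.
have: v \in [set x; y] by rewrite -eq_xy set22.
rewrite !inE => /orP[]/eqP ? /orP[]/eqP ?; subst u v => //.
- by rewrite eqxx in uv.
- by rewrite adj_sym.
- by rewrite eqxx in uv.
Qed.

Lemma edge_colorE (e : edge G) u v : val e = [set u; v] -> edge_color e = ec u v.
Proof.
move=> def_e; have uv := edge_set2 def_e.
rewrite /edge_color; have := xchooseP (edge_ends e); set p := xchoose _.
case/andP; rewrite def_e => xy /eqP eq_xy.
have: u \in [set p.1; p.2] by rewrite -eq_xy set21.
have: v \in [set p.1; p.2] by rewrite -eq_xy set22.
rewrite !inE => /orP[]/eqP vE /orP[]/eqP uE; rewrite -?uE -?vE //.
- by rewrite uE vE eqxx in uv.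
- by rewrite uE vE ec_sym.
- by rewrite uE vE eqxx in uv.
Qed.

Lemma edge_of_adj u v : adj u v -> [set u; v] \in edges G.
Proof.
by move=> uv; rewrite inE; apply/existsP; exists u; apply/existsP; exists v; rewrite uv /=.
Qed.

(** The map from [w] to [[set v; w]] is injective on neighbors of [v] and reaches every edge at
    [v]. *)
Lemma card_color_edges c v :
  #|[set e : edge G | (v \in val e) && (edge_color e == c)]| = #|color_nbrs c v|.
Proof.
rewrite -(card_imset _ val_inj) /=.
have injf : {in color_nbrs c v &, injective (fun w => [set v; w])}.
  move=> w1 w2; rewrite !inE => /andP[vw1 _] /andP[_ _] eq12.
  have: w1 \in [set v; w2] by rewrite -eq12 set22.
  by rewrite !inE => /orP[]/eqP // w1v; rewrite w1v adj_irr in vw1.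
rewrite -(card_in_imset injf); apply: eq_card => B.
apply/imsetP/imsetP => [[e] | [w]].
- rewrite inE => /andP[ve /eqP ce] ->.
  have := valP e; rewrite inE => /existsP[x /existsP[y /andP[xy /eqP def_e]]].
  have [w def_w] : exists w, val e = [set v; w].
    have: v \in [set x; y] by rewrite -def_e.
    rewrite !inE def_e => /orP[]/eqP->; first by exists y.
    by exists x; rewrite setUC.
  by exists w => //; rewrite inE (edge_adj def_w) -ce (edge_colorE def_w) /=.
- rewrite inE => /andP[vw /eqP ce] ->; exists (Sub [set v; w] (edge_of_adj vw)) => //.
  rewrite inE /= set21 /=; apply/eqP; rewrite -ce; exact: edge_colorE.
Qed.

(** [inord] is injective on colors at most [n], so passing to ['I_n.+1] preserves all degrees. *)
Lemma tlir_colorable_nat n :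
    (forall v, vc v <= n) -> (forall u v, adj u v -> ec u v <= n) ->
    (forall u v, adj u v -> color_degree (ec u v) u != color_degree (ec u v) v) ->
  tlir_colorable G n.+1.
Proof.
move=> le_vc le_ec irr.
have le_edge e : edge_color e <= n.
  rewrite /edge_color; have := xchooseP (edge_ends e); set p := xchoose _.
  by case/andP => /le_ec.
pose f : total_coloring G n.+1 :=
  [ffun z => inord (match z with inl v => vc v | inr e => edge_color e end)].
have inord_eq a b : a <= n -> b <= n -> (inord a == inord b :> 'I_n.+1) = (a == b).
  by move=> an bn; rewrite -val_eqE /= !inordK.
have degE (e : edge G) v : total_degree f (f (inr e)) v = color_degree (edge_color e) v.
  rewrite /total_degree /color_degree -card_color_edges !ffunE inord_eq //.
  by congr (_ + _); apply: eq_card => d; rewrite !inE !ffunE inord_eq.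
apply/existsP; exists f; apply/forallP=> e; apply/forallP=> u; apply/forallP=> v.
apply/implyP=> /eqP def_e; rewrite !degE (edge_colorE def_e).
exact/irr/edge_adj/def_e.
Qed.

End NeighborColoring.

(** * The coloring built from a proper coloring with [q + 2] classes *)

Section Construction.
Variables (G : sgraph) (q : nat) (col : G -> nat).
Hypothesis col_le : forall v, col v <= q.+1.
Hypothesis col_proper : forall u v, adj u v -> col u != col v.

(* The index i of the pair a_i, b_i available as colors of v. *)
Definition level v := minn (col v) q.

Definition class_nbrs i v : {set G} := [set u | adj v u & col u == i].

(* xv is the edge that v takes out of the color a_(col x). *)
Definition star x v :=
  [&& col x < level v, odd #|class_nbrs (col x) v|
    & [pick u in class_nbrs (col x) v] == Some x].

Definition leaves x : {set G} := [set v | star x v].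

Definition lone x v := star x v && (#|leaves x| == 1).

(* Meaningful only for col x < col v. *)
Definition up_color x v :=
  if star x v then
    if #|leaves x| == 1 then (level v).*2 else (col x).*2.+1
  else (col x).*2.

Definition star_color u v := if col u < col v then up_color u v else up_color v u.

(** Counts edges only: edge colors are fixed first, and the vertex color is then chosen from this
    count. *)
Definition own_degree v := #|color_nbrs star_color (level v).*2 v|.

(* Whether v gets its a-color. A single a-edge coming from a one-leaf star is
   the exception to the parity rule: v needs degree 2 there, and has no other
   a-edge on which parity matters. *)
Definition self_colored v :=
  if col v == q.+1 then odd (own_degree v)
  else ((own_degree v == 1) && [exists x, lone x v]) || ~~ odd (own_degree v).

Definition vertex_color v := (level v).*2 + ~~ self_colored v.

Lemma star_adj x v : star x v -> adj v x.
Proof.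
case/and3P => _ _; case: pickP => // u; rewrite inE => /andP[vu _] /eqP[<-] //.
Qed.

Lemma star_level x v : star x v -> col x < level v.
Proof. by case/and3P. Qed.

Lemma star_inj x y v : star x v -> star y v -> col x = col y -> x = y.
Proof.
by case/and3P => _ _ /eqP px /and3P[_ _ /eqP py] xy; move: px; rewrite xy py => -[].
Qed.

Lemma star_exists i v : i < level v -> odd #|class_nbrs i v| ->
  exists2 x, star x v & col x = i.
Proof.
move=> iv odd_i; case E: [pick u in class_nbrs i v] => [x|].
  have xi: col x = i.
    by move: E; case: pickP => // y; rewrite inE => /andP[_ /eqP yi] [<-].
  by exists x; rewrite // /star xi iv odd_i E eqxx.
move: E; case: pickP => // no _; move: odd_i.
by rewrite (eq_card (B := pred0)) ?card0.
Qed.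

(** Edges from [v] to other classes never get color [i.*2]. Among those to class [i], one is taken
    out if their number is odd, and none otherwise. *)
Lemma card_lower_class i v : i < level v ->
  ~~ odd #|color_nbrs star_color i.*2 v|.
Proof.
move=> iv.
have -> : color_nbrs star_color i.*2 v = class_nbrs i v :\: [set w | star w v].
  apply/setP=> w; rewrite !inE /star_color /up_color [RHS]andbC -andbA; apply: andb_id2l => vw.
  have := col_proper vw; have := col_le w; have := col_le v; move: iv.
  rewrite /level; case: ifP => vw_lt; case: ifP => st; try have := star_level st;
    rewrite /level; try case: ifP => _; try (have ->: star w v = false by
      apply/negP=> /star_level; rewrite /level; lia); lia.
rewrite cardsD; have [odd_i|even_i] := boolP (odd #|class_nbrs i v|).
  have [x sx xi] := star_exists iv odd_i.
  have -> : class_nbrs i v :&: [set w | star w v] = [set x].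
    apply/setP=> w; rewrite !inE; apply/andP/eqP => [[/andP[_ /eqP wi] sw]|->].
      by apply: star_inj sw sx _; rewrite wi.
    by rewrite star_adj // xi eqxx.
  by rewrite cards1; move: odd_i; case: #|_| => //= n; rewrite subn1.
rewrite (_ : _ :&: _ = set0) ?cards0 ?subn0 //; apply/setP=> w; rewrite !inE.
by apply/negP=> /andP[/andP[_ /eqP wi]] /and3P[_]; rewrite wi (negPf even_i).
Qed.

(** Such an edge at [v] goes down to the class of [x] and is taken out by [v], which takes out at
    most one edge per class. *)
Lemma card_lower_star x v : star x v -> #|leaves x| != 1 ->
  #|color_nbrs star_color (col x).*2.+1 v| = 1.
Proof.
move=> sx tx; rewrite -(cards1 x); congr #|pred_of_set _|.
apply/setP=> w; rewrite !inE /star_color /up_color.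
apply/andP/eqP => [[vw]|->]; last first.
  have lt_xv := star_level sx; rewrite star_adj // sx (negPf tx); split=> //.
  by case: ifP; move: lt_xv; rewrite /level; lia.
have := col_proper vw; have := col_le w; have := col_le v; have := star_level sx.
rewrite /level; case: ifP => vw_lt; case: ifP => st; try have := star_level st;
    rewrite /level; try case: ifP => _; try lia.
by move=> *; apply: star_inj st sx _; lia.
Qed.

(** Every other edge at [x] has a color whose index is at most [col x], hence below [level v]. *)
Lemma color_nbrs_lone x v : lone x v ->
  color_nbrs star_color (level v).*2 x = [set v].
Proof.
rewrite /lone => /andP[sx tx]; have /cards1P[y def_y] := tx.
have yE w : star x w = (w == y) by have /setP/(_ w) := def_y; rewrite !inE.
have vE : v = y by apply/eqP; rewrite -yE.
apply/setP=> w; rewrite !inE /star_color /up_color -{}vE in yE *.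
rewrite yE tx; move: (star_level sx) => lt_x_lv.
apply/andP/eqP => [[xw]|->]; last first.
  by rewrite adj_sym star_adj // eqxx; move: lt_x_lv; case: ifP; rewrite /level; lia.
have := col_proper xw; have := col_le w; have := col_le x; have := col_le v; move: lt_x_lv.
case: ifP => xw_lt; case: ifP => st; try have := star_level st;
   rewrite ?(eqP st) //= /level; try case: ifP => _; lia.
Qed.

Lemma star_color_sym u v : adj u v -> star_color u v = star_color v u.
Proof. by move=> /col_proper; rewrite /star_color; case: ltngtP. Qed.

Lemma own_degree_total v :
  color_degree vertex_color star_color (level v).*2 v = own_degree v + self_colored v.
Proof.
congr (_ + nat_of_bool _); rewrite /vertex_color.
by case: (self_colored v) => /=; lia.
Qed.

Lemma total_last_even v : col v = q.+1 -> ~~ odd (own_degree v + self_colored v).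
Proof.
by move=> vq; rewrite /self_colored vq eqxx oddD; case: (odd _).
Qed.

Lemma lower_vertex_color i v : i < level v ->
  (vertex_color v == i.*2 = false) * (vertex_color v == i.*2.+1 = false).
Proof. by rewrite /vertex_color => iv; case: (self_colored v); split=> /=; lia. Qed.

(** Off the stars, the degree is odd at [x] and even at [v]. On a one-leaf star it is 1 at [x] only;
    on a larger star it is 1 at [v] and at least 2 at [x]. *)
Lemma color_degree_irregular x v : adj x v -> col x < col v ->
  color_degree vertex_color star_color (star_color x v) x
    != color_degree vertex_color star_color (star_color x v) v.
Proof.
move=> xv lt_xv; have colE : star_color x v = up_color x v by rewrite /star_color lt_xv.
have col_xq : col x <= q by have := col_le v; lia.
have level_x : level x = col x by apply/minn_idPl.
have [sx | nsx] := boolP (star x v); last first.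
  have cE : star_color x v = (level x).*2.
    by rewrite colE /up_color (negPf nsx) level_x.
  have vx : v \in color_nbrs star_color (level x).*2 x by rewrite inE xv cE /=.
  have odd_x : odd (own_degree x + self_colored x).
    rewrite /self_colored ltn_eqF //.
    (* The exception cannot occur at [x]: a one-leaf star edge [yx] and the edge [xv] would both be
       its single a-edge, yet [y] lies below [x] and [v] above. *)
    have -> : (own_degree x == 1) && [exists y, lone y x] = false.
      apply/negP=> /andP[/cards1P[w def_w] /existsP[y loney]].
      have : x \in color_nbrs star_color (level x).*2 y.
        by rewrite (color_nbrs_lone loney) set11.
      rewrite inE => /andP[yx cy].
      have yw : y \in color_nbrs star_color (level x).*2 x.
        by rewrite inE adj_sym yx -star_color_sym.
      move: vx yw; rewrite def_w !inE => /eqP vw /eqP yw.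
      move: loney => /andP[/star_level]; rewrite level_x yw -vw; lia.
    by rewrite oddD /=; case: (odd _).
  rewrite cE own_degree_total.
  suff even_v : ~~ odd (color_degree vertex_color star_color (level x).*2 v).
    by apply: contraNneq even_v => <-.
  have [lt_x_lv | le_lv_x] := ltnP (col x) (level v).
    by rewrite /color_degree level_x lower_vertex_color // addn0 card_lower_class.
  (* Only the last class shares its pair with a lower one, and there [v] itself makes the degree
     even. *)
  have [vq lev] : col v = q.+1 /\ level v = col x.
    by move: le_lv_x; have := col_le v; rewrite /level; lia.
  by rewrite level_x -lev own_degree_total total_last_even.
have lt_x_lv := star_level sx.
rewrite colE /up_color sx; case: ifP => [tx | /negbT tx].
  have lonex : lone x v by rewrite /lone sx.
  have -> : color_degree vertex_color star_color (level v).*2 x = 1.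
    rewrite /color_degree (color_nbrs_lone lonex) cards1 /vertex_color level_x.
    by move: lt_x_lv; case: (self_colored x) => /=; lia.
  have own_gt0 : 0 < own_degree v.
    apply/card_gt0P; exists x; rewrite inE adj_sym xv -star_color_sym //.
    by rewrite colE /up_color sx tx /=.
  rewrite own_degree_total; have [vq | nvq] := eqVneq (col v) q.+1.
    by apply: contraNneq (total_last_even vq) => <-.
  have inc : [exists y, lone y v] by apply/existsP; exists x.
  (* One a-edge gives total 2 by the exception; two or more give an odd total of at least 3. *)
  by move: own_gt0; rewrite /self_colored (negPf nvq) inc andbT; case: (own_degree v) => [|[|n]].
have -> : color_degree vertex_color star_color (col x).*2.+1 v = 1.
  by rewrite /color_degree card_lower_star // lower_vertex_color.
have leaves_gt0 : 0 < #|leaves x| by apply/card_gt0P; exists v; rewrite inE.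
have leaves_sub : #|leaves x| <= #|color_nbrs star_color (col x).*2.+1 x|.
  apply/subset_leq_card/subsetP=> w; rewrite !inE => sw.
  rewrite adj_sym star_adj // /star_color /up_color sw (negPf tx).
  have -> : col x < col w by have := star_level sw; rewrite /level; lia.
  by rewrite eqxx.
by rewrite /color_degree gtn_eqF // ltn_addr // (leq_trans _ leaves_sub) // ltn_neqAle eq_sym tx.
Qed.

Lemma tlir_colorable_levels : tlir_colorable G q.+1.*2.
Proof.
rewrite doubleS; apply: (tlir_colorable_nat (vc := vertex_color) star_color_sym).
- by move=> v; rewrite /vertex_color /level; case: (self_colored v) => /=; lia.
- have up_le x y : col x < col y -> up_color x y <= q.*2.+1.
    have := col_le y; rewrite /up_color.
    case: ifP => [/star_level|_]; rewrite /level; try case: ifP => _; lia.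
  move=> u v uv; have := col_proper uv; rewrite /star_color.
  by case: ltngtP => // lt_uv _; apply: up_le.
move=> u v uv; have := col_proper uv; case: ltngtP => // lt_uv _.
  exact: color_degree_irregular.
by rewrite eq_sym star_color_sym // color_degree_irregular // adj_sym.
Qed.

End Construction.

Theorem theorem4 (G : sgraph) (chi_ge2 : 2 <= chromatic_number G) :
  tlir G <= 2 * chromatic_number G - 2.
Proof.
move: chi_ge2; rewrite /chromatic_number.
case: ex_minnP => k /existsP[f /forallP f_proper] _ k_ge2.
rewrite /tlir; case: ex_minnP => m _; apply.
(* Here [q] is [k - 2], so that the values of ['I_k] are at most [q.+1]. *)
have -> : 2 * k - 2 = (k - 2).+1.*2 by lia.
apply: (@tlir_colorable_levels G (k - 2) (fun v => f v)).
  by move=> v; have := ltn_ord (f v); lia.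
by move=> u v uv; have /forallP/(_ v)/implyP/(_ uv) := f_proper u.
Qed.
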